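(* Let $n\ge 1$ be an integer, $\alpha>0$, $0<\tau_1<\tau_2<1$ and $0<\nu<1$. Then there exists a constant $\beta$ with $0<\beta\le\alpha$, depending only on $n,\alpha,\tau_1,\tau_2,\nu$, such that the following holds. Let $\Omega\subset\mathbb{R}^n$ be a bounded domain with $0\in\partial\Omega$ that satisfies the uniform condition at $0$ with constants $\tau_1,\tau_2,\nu$ and with a sequence $\{r_k\}_{k\ge 0}$ such that $r_0=1$. Let $g:\partial\Omega\cap B_1\to\mathbb{R}$ be $C^\alpha$ at $0$, and let $u$ be a bounded viscosity solution of $$\Delta_\infty u=0 \ \text{ in } \Omega\cap B_1,\qquad u=g \ \text{ on } \partial\Omega\cap B_1 .$$ Then $u$ is $C^\beta$ at $0$ and $$|u(x)-u(0)|\le 8\,|x|^\beta\left(\|u\|_{L^\infty(\Omega\cap B_1)}+[g]_{C^\alpha(0)}\right)\qquad\text{for all } x\in\Omega\cap B_1 .$$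
   Context: Notation: $B(x,r)$ is the open ball of center $x$ and radius $r$ in $\mathbb{R}^n$, $B_r=B(0,r)$, and $\Omega^c=\mathbb{R}^n\setminus\Omega$. The infinity Laplacian is $\Delta_\infty u=\sum_{i,j=1}^n u_iu_ju_{ij}$, where $u_i=\partial u/\partial x_i$ and $u_{ij}=\partial^2u/\partial x_i\partial x_j$. Solutions are understood in the standard viscosity sense, and a viscosity solution of the boundary value problem is a continuous function on $\overline{\Omega}\cap B_1$ that solves the equation in $\Omega\cap B_1$ in the viscosity sense and equals $g$ on $\partial\Omega\cap B_1$. Uniform condition: a bounded domain $\Omega\subset\mathbb{R}^n$ satisfies the uniform condition at $x_0\in\partial\Omega$ with constants $0<\tau_1<\tau_2<1$, $0<\nu<1$ and a positive sequence $\{r_k\}_{k=0}^\infty$ if $\tau_1r_{k-1}\le r_k\le\tau_2r_{k-1}$ for all $k\ge1$, and for every $k\ge0$ there exists $y_k\in\partial B(x_0,r_k)$ such that $\partial B(x_0,r_k)\cap B(y_k,\nu r_k)\subset\Omega^c$. Pointwise Hölder regularity: a function $f$ is $C^\gamma$ at a point $x_0$ of its domain of definition (written $f\in C^\gamma(x_0)$) if there is a constant $K$ such that $|f(x)-f(x_0)|\le K|x-x_0|^\gamma$ for all $x$ in the domain of definition of $f$ (here $\partial\Omega\cap B_1$ for $g$ and $\overline{\Omega}\cap B_1$ for $u$). One denotes by $[f]_{C^\gamma(x_0)}$ the infimum of all such $K$. *)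

(* Defs.v *)
From mathcomp Require Import all_boot all_order all_algebra.
From mathcomp Require Import all_classical all_reals all_analysis.

Set Implicit Arguments.
Unset Strict Implicit.
Unset Printing Implicit Defensive.

Import Order.TTheory GRing.Theory Num.Theory numFieldNormedType.Exports.

Local Open Scope classical_set_scope.
Local Open Scope ring_scope.

Section Defs.
Context {R : realType} {n : nat}.
Local Notation Rn := 'rV[R]_n.
Implicit Types (x y c : Rn) (A D U V Omega : set Rn) (f g u phi : Rn -> R).

(* The library norm `|x| on 'rV[R]_n is the sup norm, which induces the usual
   topology and the usual bounded sets, but not the Euclidean balls. *)
Definition enorm x : R := Num.sqrt (\sum_(i < n) x 0 i ^+ 2).

Definition eball c (r : R) : set Rn := [set x | enorm (x - c) < r].

Definition boundary A : set Rn := closure A `\` interior A.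

Definition bounded_domain Omega : Prop :=
  [/\ Omega !=set0, open Omega, connected Omega & bounded_set Omega].

Definition uniform_condition (tau1 tau2 nu : R) (r : nat -> R) Omega x0 :
    Prop :=
  [/\ bounded_domain Omega /\ boundary Omega x0,
      [/\ 0 < tau1, tau1 < tau2 & tau2 < 1] /\ 0 < nu < 1,
      forall k, 0 < r k,
      forall k, tau1 * r k <= r k.+1 <= tau2 * r k
    & forall k, exists2 y, boundary (eball x0 (r k)) y &
        boundary (eball x0 (r k)) `&` eball y (nu * r k) `<=` ~` Omega].

(* Functions defined on a subset D of R^n are represented by total functions,
   constrained on D only.  Requiring 0 <= K matters only when D is contained
   in {x0}, where it makes the seminorm 0. *)
Definition holder_constants (gamma : R) D f x0 : set R :=
  [set K | 0 <= K /\
     forall x, D x -> `|f x - f x0| <= K * enorm (x - x0) `^ gamma].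

Definition holder_at gamma D f x0 : Prop :=
  holder_constants gamma D f x0 !=set0.

Definition holder_seminorm gamma D f x0 : R :=
  inf (holder_constants gamma D f x0).

(* Null sets of the n-dimensional Lebesgue measure, through countable covers
   by closed boxes of arbitrarily small total volume. *)
Definition box (a b : Rn) : set Rn :=
  [set x | forall i : 'I_n, a 0 i <= x 0 i <= b 0 i].

Definition lebesgue_null A : Prop :=
  forall e : R, 0 < e -> exists a b : nat -> Rn,
    [/\ forall k (i : 'I_n), a k 0 i <= b k 0 i,
        A `<=` \bigcup_k box (a k) (b k)
      & (\sum_(0 <= k <oo) (\prod_(i < n) (b k 0 i - a k 0 i))%:E <= e%:E)%E].

(* Essential supremum of |u| on U; meaningful when u is essentially bounded. *)
Definition Linfty_norm U u : R :=
  inf [set M : R | 0 <= M /\ lebesgue_null (U `&` [set x | M < `|u x|])].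

Definition partial (i : 'I_n) f : Rn -> R := fun x => 'D_(delta_mx 0 i) f x.

Definition C2_on V f : Prop := forall x, V x ->
  [/\ {for x, continuous f},
      forall i, derivable f x (delta_mx 0 i) /\
                {for x, continuous (partial i f)}
    & forall i j, derivable (partial j f) x (delta_mx 0 i) /\
                  {for x, continuous (partial i (partial j f))}].

Definition infty_laplacian f x : R :=
  \sum_(i < n) \sum_(j < n)
    partial i f x * partial j f x * partial i (partial j f) x.

Definition viscosity_subsolution U u : Prop :=
  forall x phi V, U x -> open V -> V x -> C2_on V phi ->
    (\forall y \near x, U y -> u y - phi y <= u x - phi x) ->
    0 <= infty_laplacian phi x.

Definition viscosity_supersolution U u : Prop :=
  forall x phi V, U x -> open V -> V x -> C2_on V phi ->
    (\forall y \near x, U y -> u x - phi x <= u y - phi y) ->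
    infty_laplacian phi x <= 0.

(* Infinity Laplace equation in Omega `&` B_1, with u = g on the part of the
   boundary of Omega lying in B_1. *)
Definition viscosity_solution Omega g u : Prop :=
  [/\ {within closure Omega `&` eball 0 1, continuous u},
      viscosity_subsolution (Omega `&` eball 0 1) u,
      viscosity_supersolution (Omega `&` eball 0 1) u
    & forall x, (boundary Omega `&` eball 0 1) x -> u x = g x].

End Defs.

(* Main.v *)
Require Import Defs.
From mathcomp Require Import all_boot all_order all_algebra.
From mathcomp Require Import all_classical all_reals all_analysis.
From mathcomp Require Import measurable_realfun ring lra.
Import Order.TTheory GRing.Theory Num.Theory numFieldNormedType.Exports.
Local Open Scope classical_set_scope.
Local Open Scope ring_scope.

(* For every [e > 0], [c - e / |x - z|^2] is a smooth strict supersolution of the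
   infinity Laplace equation away from [z], so that [u] lies below it on an
   annulus once it does so on the boundary.  With [z] just outside the ball of
   radius [r_k], facing the removed cap, this bounds [u - u(0)] away from its
   supremum near the cap; a chain of annuli of controlled length propagates the
   gain to the ball of radius [tau2 r_k].  Hence the supremum [S_k] of [u - u(0)]
   on the ball of radius [r_k] satisfies
   [S_(k+1) <= (1 - delta) S_k + delta [g] r_k^alpha] with [delta] depending
   only on [nu] and [tau2], and [beta] is chosen so that
   [tau1^beta >= 1 - delta / 2].  The same applies to [u(0) - u]. *)

Lemma cvg_sumr {R : realType} {T I : Type} (F : set_system T) {FF : Filter F}
    (s : seq I) (f : I -> T -> R) (l : I -> R) :
  (forall i, f i @ F --> l i) ->
  \sum_(i <- s) f i x @[x --> F] --> \sum_(i <- s) l i.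
Proof.
move=> fl; elim: s => [|i s IH].
  by under eq_fun do rewrite big_nil; rewrite big_nil; exact: cvg_cst.
by under eq_fun do rewrite big_cons; rewrite big_cons; apply: cvgD.
Qed.

(** * The Euclidean norm: Cauchy-Schwarz, triangle inequality, continuity, spheres *)

Section EuclideanNorm.
Context {R : realType} {n : nat}.
Implicit Types (x y z c : 'rV[R]_n) (r : R).

Lemma enorm_ge0 x : 0 <= enorm x.
Proof. exact: sqrtr_ge0. Qed.

Lemma enorm_sqr x : enorm x ^+ 2 = \sum_(i < n) x 0 i ^+ 2.
Proof. by rewrite sqr_sqrtr// sumr_ge0// => i _; exact: sqr_ge0. Qed.

Lemma enormZ (a : R) x : enorm (a *: x) = `|a| * enorm x.
Proof.
rewrite /enorm -sqrtr_sqr -sqrtrM ?sqr_ge0// mulr_sumr; congr Num.sqrt.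
by apply: eq_bigr => i _; rewrite mxE exprMn.
Qed.

Lemma enorm0 : enorm (0 : 'rV[R]_n) = 0.
Proof. by rewrite -(scale0r 0) enormZ normr0 mul0r. Qed.

Lemma enormN x : enorm (- x) = enorm x.
Proof. by rewrite -scaleN1r enormZ normrN1 mul1r. Qed.

Lemma enormBC x y : enorm (x - y) = enorm (y - x).
Proof. by rewrite -enormN opprB. Qed.

Lemma coord_le_enorm x (i : 'I_n) : `|x 0 i| <= enorm x.
Proof.
rewrite -sqrtr_sqr ler_wsqrtr// (bigD1 i)//= lerDl sumr_ge0// => j _.
exact: sqr_ge0.
Qed.

Lemma enorm_eq0 x : enorm x = 0 -> x = 0.
Proof.
move=> x0; apply/rowP => i; apply/eqP; rewrite mxE -normr_le0 -x0.
exact: coord_le_enorm.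
Qed.

Lemma normr_le_enorm x : `|x| <= enorm x.
Proof.
rewrite /Num.norm/= mx_normrE; apply/bigmax_leP; split => [|[i j] _ /=].
  exact: enorm_ge0.
by rewrite ord1 coord_le_enorm.
Qed.

(** Cauchy-Schwarz: if B is the scalar product and x is nonzero, the squared norm of |x|^2 y - B x
    equals |x|^2 (|x|^2 |y|^2 - B^2). *)
Lemma dot_le_enorm x y : \sum_(i < n) x 0 i * y 0 i <= enorm x * enorm y.
Proof.
have [x0|x0] := eqVneq (enorm x) 0.
  rewrite x0 mul0r; have -> := enorm_eq0 _ x0.
  by rewrite big1// => i _; rewrite mxE mul0r.
have xp : 0 < enorm x by rewrite lt_neqAle eq_sym x0 enorm_ge0.
set B := \sum_(i < n) _.
have : 0 <= \sum_(i < n) (enorm x ^+ 2 * y 0 i - B * x 0 i) ^+ 2.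
  by apply: sumr_ge0 => i _; exact: sqr_ge0.
have -> : \sum_(i < n) (enorm x ^+ 2 * y 0 i - B * x 0 i) ^+ 2 =
    enorm x ^+ 2 * ((enorm x * enorm y) ^+ 2 - B ^+ 2).
  rewrite (eq_bigr (fun i => (enorm x ^+ 2) ^+ 2 * y 0 i ^+ 2
      - 2 * enorm x ^+ 2 * B * (x 0 i * y 0 i) + B ^+ 2 * x 0 i ^+ 2)); last first.
    by move=> i _; ring.
  rewrite big_split/= sumrB -!mulr_sumr -!enorm_sqr -/B; ring.
rewrite pmulr_rge0 ?exprn_gt0// subr_ge0 => BB.
have xy0 : 0 <= enorm x * enorm y by rewrite mulr_ge0// enorm_ge0.
by rewrite (le_trans (ler_norm _))// -ler_sqr ?nnegrE// -normrX ger0_norm ?sqr_ge0.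
Qed.

Lemma ler_enormD x y : enorm (x + y) <= enorm x + enorm y.
Proof.
rewrite -ler_sqr ?nnegrE ?addr_ge0 ?enorm_ge0//.
have -> : enorm (x + y) ^+ 2 =
    enorm x ^+ 2 + enorm y ^+ 2 + 2 * \sum_(i < n) x 0 i * y 0 i.
  rewrite !enorm_sqr mulr_sumr -!big_split/=.
  by apply: eq_bigr => i _; rewrite mxE; ring.
by have := dot_le_enorm x y; nra.
Qed.

Lemma ler_enorm_dist x y z : enorm (x - z) <= enorm (x - y) + enorm (y - z).
Proof. by rewrite -(subrKA y) ler_enormD. Qed.

(** A polynomial in the coordinates, hence smooth also at z, where the norm is not; derivatives are
    computed from it. *)
Definition sqdist z y : R := \sum_(i < n) (y 0 i - z 0 i) ^+ 2.

Lemma sqdistE z y : sqdist z y = enorm (y - z) ^+ 2.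
Proof. by rewrite enorm_sqr; apply: eq_bigr => i _; rewrite !mxE. Qed.

Lemma sqdist_continuous z : continuous (sqdist z).
Proof.
move=> x; have FF : Filter (nbhs x) := @nbhs_filter 'rV[R]_n x.
apply: (@cvg_sumr R _ _ _ FF) => i.
by apply: (@cvgM _ _ _ FF); apply: (@cvgB _ _ _ _ FF);
  (exact: coord_continuous || exact: (@cvg_cst _ _ _ _ FF)).
Qed.

Lemma enorm_continuous z : continuous (fun y => enorm (y - z)).
Proof.
move=> x; under eq_fun do
  rewrite -(ger0_norm (enorm_ge0 _)) -sqrtr_sqr -sqdistE.
apply: continuous_comp; [exact: sqdist_continuous|exact: sqrt_continuous].
Qed.

Lemma open_eball c r : open (eball c r).
Proof.
apply: (@open_comp _ _ (fun y : 'rV[R]_n => enorm (y - c)) [set t | t < r]).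
  by move=> y _; exact: enorm_continuous.
exact: open_lt.
Qed.

(** A point x of the sphere is the limit of the points t x of the open ball as t increases to 1. *)
Lemma boundary_eball r : 0 < r ->
  boundary (eball 0 r) = [set x : 'rV[R]_n | enorm x = r].
Proof.
move=> r0; apply/seteqP; split => x; rewrite /boundary /=.
  move=> [xc]; rewrite ((interior_id _).1 (open_eball 0 r)) /eball/=.
  move=> /negP; rewrite -leNgt subr0 => rx.
  apply/eqP; rewrite eq_le rx andbT.
  have cl : closed [set y : 'rV[R]_n | enorm (y - 0) <= r].
    apply: (@preimage_closed _ _ (fun y : 'rV[R]_n => enorm (y - 0)) [set t | t <= r]).
      by move=> y _; exact: enorm_continuous.
    exact: closed_le.
  have : closure [set y : 'rV[R]_n | enorm (y - 0) <= r] x.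
    by apply: closure_subset xc => y /ltW.
  by rewrite -((closure_id _).1 cl)/= subr0.
move=> xr; split; last first.
  by rewrite ((interior_id _).1 (open_eball 0 r))/eball/= subr0 xr ltxx.
have tx : (fun t : R => t *: x) @ 1^'- --> x.
  apply: cvg_at_left_filter; rewrite -[X in _ --> X]scale1r.
  by apply: cvgZr_tmp; exact: cvg_id.
move=> B Bx; have := tx _ Bx => /= tB.
near (1:R)^'- => t; exists (t *: x); split; last by near: t.
rewrite /eball/= subr0 enormZ xr gtr0_norm; last by near: t; exact: nbhs_left_gt.
rewrite -ltr_pdivlMr// divff ?gt_eqF//; near: t; exact: nbhs_left_lt.
Unshelve. all: end_near. Qed.
End EuclideanNorm.

(** * Derivatives and infinity Laplacian of the inverse square distance *)

Section InverseSquareDistance.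
Context {R : realType} {n : nat}.
Implicit Types (x y z v : 'rV[R]_n) (e : R).

Lemma is_derive_coord x v (j : 'I_n) :
  is_derive x v (fun y => y 0 j : R) (v 0 j).
Proof.
have lim_coord : h^-1 *: (((h *: v + x) 0 j : R) - x 0 j) @[h --> 0^'] --> v 0 j.
  apply: cvg_near_cst; near=> h; rewrite !mxE addrK /GRing.scale/= mulKf//.
  by near: h; exact: nbhs_dnbhs_neq.
by split; [apply/cvg_ex; exists (v 0 j)|exact: cvg_lim lim_coord].
Unshelve. all: end_near. Qed.

Lemma is_derive_sqdist z x (i : 'I_n) :
  is_derive x (delta_mx 0 i) (sqdist z) (2 * (x 0 i - z 0 i)).
Proof.
rewrite (_ : sqdist z = \sum_(j < n) ((fun y => y 0 j : R) - cst (z 0 j)) ^+ 2).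
  apply: is_derive_eq.
    apply: is_derive_sum => j; apply: is_deriveX; apply: is_deriveB.
    exact: is_derive_coord.
  rewrite (bigD1 i)//= big1 ?addr0; last first.
    by move=> j ji; rewrite mxE eqxx/= (negbTE ji) subr0 scaler0.
  by rewrite mxE !eqxx subr0 /GRing.scale/= mulr1 expr1.
by apply/funext => y; rewrite fct_sumE.
Qed.

Definition invsq e z y : R := e * (sqdist z y)^-1.

Lemma is_derive_sqdistV z x (i : 'I_n) : sqdist z x != 0 ->
  is_derive x (delta_mx 0 i) (fun y => (sqdist z y)^-1)
    (- sqdist z x ^- 2 * (2 * (x 0 i - z 0 i))).
Proof.
move=> q0; have [dq Dq] := is_derive_sqdist z x i.
by split; [exact: derivableV|rewrite deriveV// Dq].
Qed.

Lemma is_derive_invsq e z x (i : 'I_n) : sqdist z x != 0 ->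
  is_derive x (delta_mx 0 i) (invsq e z)
    (- 2 * e * (x 0 i - z 0 i) * (sqdist z x)^-1 ^+ 2).
Proof.
move=> q0; apply: is_derive_eq.
  by apply: is_deriveZ; exact: is_derive_sqdistV.
by rewrite /GRing.scale/= exprVn; ring.
Qed.

(** Closed forms of the first and second derivatives of [invsq]. They hold on the open set y != z,
    so they can be differentiated again there and pass their continuity on to the iterated partial
    derivatives. *)
Definition partial_invsq e z (j : 'I_n) y : R :=
  - 2 * e * (y 0 j - z 0 j) * (sqdist z y)^-1 ^+ 2.

Definition partial2_invsq e z (i j : 'I_n) y : R :=
  - 2 * e * ((i == j)%:R * (sqdist z y)^-1 ^+ 2
    - 4 * (y 0 i - z 0 i) * (y 0 j - z 0 j) * (sqdist z y)^-1 ^+ 3).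

Lemma is_derive_partial_invsq e z x (i j : 'I_n) : sqdist z x != 0 ->
  is_derive x (delta_mx 0 i) (partial_invsq e z j) (partial2_invsq e z i j x).
Proof.
move=> q0.
rewrite (_ : partial_invsq e z j = (- 2 * e) \*:
    (((fun y => y 0 j : R) - cst (z 0 j)) * (fun y => (sqdist z y)^-1) ^+ 2)).
  apply: is_derive_eq.
    apply: is_deriveZ; apply: is_deriveM.
      by apply: is_deriveB; exact: is_derive_coord.
    by apply: is_deriveX; exact: is_derive_sqdistV.
  rewrite /partial2_invsq mxE eqxx/= eq_sym subr0 /GRing.scale/=.
  rewrite [X in X * (i == j)%:R](_ : _ = (sqdist z x)^-1 ^+ 2)//.
  rewrite [X in X * (_ * _)](_ : _ = x 0 j - z 0 j)// !exprVn.
  by field.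
by apply/funext => y; rewrite /partial_invsq /GRing.scale/= -mulrA.
Qed.

Lemma open_punctured z : open [set y | sqdist z y != 0].
Proof.
apply: (@open_comp _ _ (sqdist z) [set t | t != 0]); last exact: open_neq.
by move=> y _; exact: sqdist_continuous.
Qed.

Lemma near_punctured z x : sqdist z x != 0 -> \forall y \near x, sqdist z y != 0.
Proof. by move=> q0; exact: (open_nbhs_nbhs (conj (open_punctured z) q0)). Qed.

Lemma near_partial_invsq e z x (j : 'I_n) : sqdist z x != 0 ->
  \forall y \near x, partial_invsq e z j y = partial j (invsq e z) y.
Proof.
move=> /near_punctured; apply: filterS => y q0.
by have [_ d] := is_derive_invsq e z y j q0; rewrite /partial d.
Qed.

Lemma is_derive_partial2 e z x (i j : 'I_n) : sqdist z x != 0 ->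
  is_derive x (delta_mx 0 i) (partial j (invsq e z)) (partial2_invsq e z i j x).
Proof.
move=> q0; apply: near_eq_is_derive; last exact: is_derive_partial_invsq.
exact: near_partial_invsq.
Qed.

Lemma near_partial2_invsq e z x (i j : 'I_n) : sqdist z x != 0 ->
  \forall y \near x,
    partial2_invsq e z i j y = partial i (partial j (invsq e z)) y.
Proof.
move=> /near_punctured; apply: filterS => y q0.
by have [_ d] := is_derive_partial2 e z y i j q0; rewrite /(partial i) d.
Qed.

Lemma near_eq_continuous (f g : 'rV[R]_n -> R) x :
  (\forall y \near x, f y = g y) -> {for x, continuous f} ->
  {for x, continuous g}.
Proof.
move=> fg; rewrite /prop_for /continuous_at (nbhs_singleton fg) => cf.
have FF : Filter (nbhs x) := @nbhs_filter 'rV[R]_n x.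
by apply: cvg_trans cf; exact: (@near_eq_cvg _ _ _ FF).
Qed.

Lemma sqdistV_continuous z x : sqdist z x != 0 ->
  {for x, continuous (fun y => (sqdist z y)^-1)}.
Proof. by move=> q0; apply: continuousV => //; exact: sqdist_continuous. Qed.

Lemma coordB_continuous z x (j : 'I_n) :
  {for x, continuous (fun y => y 0 j - z 0 j : R)}.
Proof.
by apply: continuousB; [exact: coord_continuous|exact: cst_continuous].
Qed.

Lemma C2_invsq e z : C2_on [set y | sqdist z y != 0] (invsq e z).
Proof.
move=> x /= q0; have cV := sqdistV_continuous _ _ q0; split.
- by apply: continuousM => //; exact: cst_continuous.
- move=> i; split; first by have [] := is_derive_invsq e z x i q0.
  apply: near_eq_continuous (near_partial_invsq e z x i q0) _.
  apply: continuousM; last by apply: continuousM.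
  by apply: continuousM; [exact: cst_continuous|exact: coordB_continuous].
- move=> i j; split; first by have [] := is_derive_partial2 e z x i j q0.
  apply: near_eq_continuous (near_partial2_invsq e z x i j q0) _.
  apply: continuousM; first exact: cst_continuous.
  apply: continuousB.
    by apply: continuousM; [exact: cst_continuous|apply: continuousM].
  apply: continuousM; last by apply: continuousM => //; exact: continuousM.
  apply: continuousM; last exact: coordB_continuous.
  by apply: continuousM; [exact: cst_continuous|exact: coordB_continuous].
Qed.

(** With w = x - z and s = 1 / |w|^2, the gradient is -2 e s^2 w and the Hessian is -2 e (s^2 I - 4
    s^3 w w^T). The contraction is 32 e^3 s^7 |w|^4 - 8 e^3 s^6 |w|^2, where |w|^2 = 1 / s. Its sign
    is that of e. *)
Lemma infty_laplacian_invsq e z x : sqdist z x != 0 ->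
  infty_laplacian (invsq e z) x = 24 * e ^+ 3 * (sqdist z x)^-1 ^+ 5.
Proof.
move=> q0; rewrite /infty_laplacian.
set s := (sqdist z x)^-1; pose w (i : 'I_n) := x 0 i - z 0 i.
have sw : \sum_(i < n) w i ^+ 2 = s^-1 by rewrite invrK.
have s0 : s != 0 by rewrite invr_eq0.
transitivity (\sum_(i < n) \sum_(j < n)
  (32 * e ^+ 3 * s ^+ 7 * (w i ^+ 2 * w j ^+ 2)
   - (i == j)%:R * (8 * e ^+ 3 * s ^+ 6 * w i * w j))).
  apply: eq_bigr => i _; apply: eq_bigr => j _.
  have [_ Dij] := is_derive_partial2 e z x i j q0.
  have [_ Di] := is_derive_invsq e z x i q0.
  have [_ Dj] := is_derive_invsq e z x j q0.
  rewrite /(partial i (partial _ _)) Dij /partial Di Dj /partial2_invsq.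
  by rewrite -/s -/(w i) -/(w j); ring.
transitivity (\sum_(i < n) (32 * e ^+ 3 * s ^+ 6 * w i ^+ 2
    - 8 * e ^+ 3 * s ^+ 6 * w i ^+ 2)).
  apply: eq_bigr => i _; rewrite sumrB; congr (_ - _).
    rewrite -!mulr_sumr sw; field.
    by rewrite s0.
  rewrite (bigD1 i)//= eqxx mul1r big1 ?addr0; first by ring.
  by move=> j ji; rewrite eq_sym (negbTE ji) mul0r.
by rewrite sumrB -!mulr_sumr sw; field.
Qed.

End InverseSquareDistance.

(** * Comparison with inverse-square barriers on annuli *)

Section Comparison.
Context {R : realType} {n : nat}.
Implicit Types (x y z : 'rV[R]_n) (Omega U : set 'rV[R]_n).
Implicit Types (u v : 'rV[R]_n -> R).

(** All that the later estimates keep of the equation. A solution u and its opposite -u both have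
    this property, so each estimate is proved from above only. *)
Definition no_invsq_contact U v := forall x z (d : R),
  U x -> sqdist z x != 0 -> 0 < d ->
  ~ (\forall y \near x, U y -> v y + invsq d z y <= v x + invsq d z x).

Lemma sqdist_gt0 z x : sqdist z x != 0 -> 0 < sqdist z x.
Proof. by rewrite sqdistE lt_neqAle eq_sym => ->; exact: sqr_ge0. Qed.

(** At a contact, -d / |y - z|^2 would touch u from above with infinity Laplacian -24 d^3 / |x -
    z|^10 < 0. *)
Lemma subsolution_no_invsq_contact U u :
  viscosity_subsolution U u -> no_invsq_contact U u.
Proof.
move=> usub x z d Ux q0 d0 H.
have q1 := sqdist_gt0 _ _ q0.
have contact : \forall y \near x, U y ->
    u y - invsq (- d) z y <= u x - invsq (- d) z x.
  by apply: filterS H => y H /H; rewrite /invsq !mulNr !opprK.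
have := usub x _ _ Ux (open_punctured z) q0 (C2_invsq _ _) contact.
rewrite infty_laplacian_invsq//.
have i5 : 0 < (sqdist z x)^-1 ^+ 5 by rewrite exprn_gt0// invr_gt0.
have d3 : 0 < d ^+ 3 by rewrite exprn_gt0.
have := mulr_gt0 d3 i5.
by rewrite exprNn; nra.
Qed.

(** Now d / |y - z|^2 would touch u from below with a positive infinity Laplacian. *)
Lemma supersolution_no_invsq_contact U u :
  viscosity_supersolution U u -> no_invsq_contact U (fun x => - u x).
Proof.
move=> usup x z d Ux q0 d0 H.
have q1 := sqdist_gt0 _ _ q0.
have contact : \forall y \near x, U y ->
    u x - invsq d z x <= u y - invsq d z y.
  by apply: filterS H => y H /H; lra.
have := usup x _ _ Ux (open_punctured z) q0 (C2_invsq _ _) contact.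
rewrite infty_laplacian_invsq//.
have i5 : 0 < (sqdist z x)^-1 ^+ 5 by rewrite exprn_gt0// invr_gt0.
have d3 : 0 < d ^+ 3 by rewrite exprn_gt0.
have := mulr_gt0 d3 i5.
by nra.
Qed.

Lemma compact_annulus Omega (r s t : R) z :
  compact (closure Omega `&` [set x | enorm x <= r]
           `&` [set x | s <= enorm (x - z) <= t]).
Proof.
apply: bounded_closed_compact.
  exists r; split; first exact: num_real.
  move=> M rM x [[_ /= xr] _]; apply: le_trans (normr_le_enorm x) _.
  exact: le_trans xr (ltW rM).
have cl (c : 'rV[R]_n) (P : set R) : closed P -> closed [set x | P (enorm (x - c))].
  move=> cP; apply: (@preimage_closed _ _ (fun y : 'rV[R]_n => enorm (y - c)) P _ cP).
  by move=> y _; exact: enorm_continuous.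
apply: closedI; first apply: closedI.
- exact: closed_closure.
- have := cl 0 _ (@closed_le _ r).
  by congr (closed _); apply/seteqP; split => x /=; rewrite subr0.
- have := closedI (cl z _ (@closed_le _ t)) (cl z _ (@closed_ge _ s)).
  congr (closed _); apply/seteqP; split => x /=; first by move=> [-> ->].
  by move=> /andP[-> ->].
Qed.

(* [v] is compared with the barrier [c - d / |x - z|^2], a strict supersolution
   equal to [(1 - delta) M] on [|x - z| = s] and to [M] on [|x - z| = 4 s].
   When the annulus leaves the ball [|x| <= r], it must do so outside [Omega]. *)
Lemma annulus_decrease Omega v (r s M delta : R) z :
  open Omega -> r < 1 -> 0 < s -> 0 <= M -> 0 < delta <= 1 ->
  {within closure Omega `&` eball 0 1, continuous v} ->
  no_invsq_contact (Omega `&` eball 0 1) v ->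
  (forall x, closure Omega x -> enorm x <= r -> v x <= M) ->
  (forall x, closure Omega x -> enorm x <= r -> ~ Omega x -> v x <= 0) ->
  (forall x, closure Omega x -> enorm x <= r -> enorm (x - z) <= s ->
     v x <= (1 - delta) * M) ->
  (forall x, Omega x -> enorm x = r -> 4 * s <= enorm (x - z)) ->
  forall x, closure Omega x -> enorm x <= r -> enorm (x - z) <= 2 * s ->
    v x <= (1 - delta / 5) * M.
Proof.
move=> oO r1 s0 M0 /andP[d0 d1] cv bv vM vb vs vr x Ox xr xz.
have [M00|Mn0] := eqVneq M 0.
  by rewrite M00 mulr0 -M00; exact: vM.
have Mp : 0 < M by rewrite lt_neqAle eq_sym Mn0.
have dM : 0 < delta * M by rewrite mulr_gt0.
rewrite leNgt; apply/negP => vx.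
have sx : s < enorm (x - z).
  rewrite ltNge; apply/negP => /(vs _ Ox xr); nra.
(* Chosen so that d / s^2 - d / (4 s)^2 = delta M. At distance k s from z the barrier term is 16/15
   delta M / k^2. *)
pose d := 16 / 15 * (delta * M) * s ^+ 2.
have s2 : 0 < s ^+ 2 by rewrite exprn_gt0.
have dp : 0 < d by rewrite !mulr_gt0.
pose K := closure Omega `&` [set x | enorm x <= r]
           `&` [set x | s <= enorm (x - z) <= 4 * s].
have Kx : K x by split; [split|]=> //=; rewrite (ltW sx)/=; lra.
have qK y : s <= enorm (y - z) -> sqdist z y != 0.
  by move=> sy; rewrite sqdistE expf_neq0// gt_eqF//; lra.
have invle y (k : R) : 0 < k -> k * s <= enorm (y - z) ->
    invsq d z y <= 16 / 15 * (delta * M) / k ^+ 2.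
  move=> k0 ky; rewrite /invsq sqdistE.
  have ks : 0 < k * s by rewrite mulr_gt0.
  rewrite (_ : _ / k ^+ 2 = d * ((k * s) ^+ 2)^-1); last first.
    by rewrite /d; field; rewrite !gt_eqF.
  rewrite ler_pM2l// lef_pV2 ?posrE ?exprn_gt0//; last by lra.
  by rewrite ler_sqr ?nnegrE//; lra.
have cf : {within K, continuous (fun y => v y + invsq d z y)}.
  have cvK : {within K, continuous v}.
    apply: continuous_subspaceW cv => y [[Oy /= yr] _]; split => //.
    by rewrite /eball/= subr0; lra.
  have ciK : {within K, continuous (invsq d z)}.
    apply: continuous_in_subspaceT => y /set_mem[_ /= /andP[sy _]].
    by have [] := C2_invsq d z y (qK y sy).
  by move=> y; apply: continuousD; [exact: cvK|exact: ciK].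
have [x0 /set_mem K0 mx0] := compact_EVT_max (ex_intro _ x Kx)
  (compact_annulus Omega r s (4 * s) z) cf.
(* At distance 2 s the barrier is c - 4/15 delta M = (1 - delta / 5) M, which is where the factor 5
   arises. The maximum of [v + invsq d z] on [K] therefore exceeds [c]; each part of the boundary of
   [K] is now ruled out for the maximum point. *)
pose c := M + delta * M / 15.
have fx : c < v x + invsq d z x.
  have : 4 / 15 * (delta * M) <= invsq d z x.
    rewrite /invsq sqdistE.
    rewrite (_ : 4 / 15 * _ = d * ((2 * s) ^+ 2)^-1); last first.
      by rewrite /d; field; rewrite gt_eqF.
    rewrite ler_pM2l// lef_pV2 ?posrE ?exprn_gt0//; [|lra|lra].
    by rewrite ler_sqr ?nnegrE//; lra.
  by rewrite /c; lra.
have f0 : c < v x0 + invsq d z x0 by apply: lt_le_trans fx (mx0 _ (mem_set Kx)).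
move: K0 => [[Ox0 /= x0r] /andP[sx0 x0s]].
have inv1 := invle x0 1 ltr01; rewrite mul1r expr1n divr1 in inv1.
have {}inv1 := inv1 sx0.
(* Off [Omega] the sum is at most 16/15 delta M, and this is at most [c] because delta <= 1. *)
have Ox0' : Omega x0.
  apply: contrapT => nO; have := vb _ Ox0 x0r nO.
  by move: f0; rewrite /c; nra.
have x0s' : enorm (x0 - z) < 4 * s.
  rewrite ltNge; apply/negP => x04.
  have := invle x0 4 (ltr0n _ 4) x04; have := vM _ Ox0 x0r.
  by move: f0; rewrite /c; lra.
have sx0' : s < enorm (x0 - z).
  rewrite ltNge; apply/negP => /(vs _ Ox0 x0r); move: f0; rewrite /c; lra.
have x0r' : enorm x0 < r.
  rewrite lt_neqAle x0r andbT; apply/eqP => /(vr _ Ox0'); lra.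
apply: (bv x0 z d) => //.
- by split => //; rewrite /eball/= subr0; lra.
- exact: qK.
have near_lt (g : 'rV[R]_n -> R) (P : set R) : continuous g -> open P ->
    P (g x0) -> \forall y \near x0, P (g y).
  move=> cg oP Pg; apply: (cg x0); exact: (open_nbhs_nbhs (conj oP Pg)).
(* All constraints are strict at [x0], so [K] is a neighbourhood of [x0] and the maximum over [K] is
   a local one. *)
near=> y => _; apply: mx0; apply/mem_set; split; first split.
- by apply: subset_closure; near: y; exact: (open_nbhs_nbhs (conj oO Ox0')).
- apply: ltW; rewrite -[y]subr0.
  near: y.
  apply: (near_lt _ [set t | t < r] (enorm_continuous 0) (@open_lt _ _)).
  by rewrite /= subr0.
- apply/andP; split; apply: ltW; near: y.
    exact: (near_lt _ [set t | s < t] (enorm_continuous z) (@open_gt _ _)).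
  exact: (near_lt _ [set t | t < 4 * s] (enorm_continuous z) (@open_lt _ _)).
Unshelve. all: end_near. Qed.

End Comparison.

(** * Decay of the supremum from a ball to a smaller concentric one *)

Section Decay.
Context {R : realType}.

Definition ball_decay (n : nat) (nu tau delta : R) : Prop :=
  forall (Omega : set 'rV[R]_n) (v : 'rV[R]_n -> R) (r M : R) y,
  open Omega -> 0 < r < 1 -> 0 <= M ->
  {within closure Omega `&` eball 0 1, continuous v} ->
  no_invsq_contact (Omega `&` eball 0 1) v ->
  (forall x, closure Omega x -> enorm x <= r -> v x <= M) ->
  (forall x, closure Omega x -> enorm x <= r -> ~ Omega x -> v x <= 0) ->
  enorm y = r ->
  (forall x, enorm x = r -> enorm (x - y) < nu * r -> ~ Omega x) ->
  forall x, closure Omega x -> enorm x <= tau * r -> v x <= (1 - delta) * M.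

(* A first annulus centred outside the ball, beyond the removed cap, gives a
   gain near [z1]; a chain of [N] annuli centred inside carries it to every
   point of the smaller ball, losing a factor 5 at each step. *)
Lemma ball_decay_exists (nu tau : R) : 0 < nu < 1 -> tau < 1 ->
  exists2 delta : R, 0 < delta <= 1 & forall n, ball_decay n nu tau delta.
Proof.
move=> /andP[nu0 nu1] tau1.
(* The bound nu / 25 puts the ball of radius [theta * r] about [z1] within 2 nu r / 5 of [z0]. The
   bound (1 - tau) / 4 gives tau <= 1 - 4 theta, so points of the smaller ball are admissible
   centres. *)
pose theta := Num.min (nu / 25) ((1 - tau) / 4).
have theta0 : 0 < theta by rewrite lt_min; apply/andP; split; lra.
have thetanu : theta <= nu / 25 by rewrite ge_min lexx.
have thetatau : theta <= (1 - tau) / 4 by rewrite ge_min lexx orbT.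
(* Enough steps of length [theta * r] to join any two points of the ball of radius r. *)
pose N := (Num.truncn (2 / theta)).+1.
have thetaN : 2 <= N%:R * theta.
  by rewrite -ler_pdivrMr//; apply: ltW; rewrite /N; exact: truncnS_gt.
have p5 j : 0 < (5^-1 : R) ^+ j <= 1.
  by rewrite exprn_gt0//= exprn_ile1//; lra.
exists (5^-1 ^+ N.+1); first exact: p5.
move=> n Omega v r M y oO /andP[r0 r1] M0 cv bv vM vb yr cap x Ox xr.
have thr : 0 < theta * r by rewrite mulr_gt0.
(* A centre p with |p| <= (1 - 4 theta) r is at distance at least 4 theta r from the sphere, as
   [annulus_decrease] requires for s = theta r. *)
pose z1 := (1 - 4 * theta) *: y.
have z1r : enorm z1 = (1 - 4 * theta) * r.
  by rewrite enormZ yr ger0_norm//; lra.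
suff chain j : forall p, enorm p <= (1 - 4 * theta) * r ->
    enorm (p - z1) <= j%:R * theta * r ->
    forall x, closure Omega x -> enorm x <= r -> enorm (x - p) <= theta * r ->
    v x <= (1 - 5^-1 ^+ j.+1) * M.
  apply: (chain N x) => //.
  - by nra.
  - apply: (@le_trans _ _ (2 * r)); last by rewrite ler_wpM2r// ltW.
    have := ler_enormD x (- z1); rewrite enormN z1r; nra.
  - by nra.
  - by rewrite subrr enorm0; lra.
elim: j => [|j IH] p pr pz {}x {}Ox {}xr xp.
  have {pz} pz : p = z1.
    apply/eqP; rewrite -subr_eq0; apply/eqP/enorm_eq0/eqP.
    by rewrite eq_le enorm_ge0 andbT; move: pz; rewrite !mul0r.
  (* With s = nu r / 5, the closed ball of radius s about [z0] meets the ball of radius r only on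
     the sphere and inside the cap, where v <= 0; hence delta = 1. Sphere points outside the cap are
     at distance at least nu r - s = 4 s from [z0]. *)
  pose z0 := (1 + nu / 5) *: y.
  have xz0 x' : enorm (x' - y) <= enorm (x' - z0) + nu / 5 * r.
    apply: le_trans (ler_enorm_dist _ z0 _) _; rewrite lerD2l.
    rewrite (_ : z0 - y = (nu / 5) *: y); last first.
      by rewrite /z0 scalerDl scale1r addrC addKr.
    by rewrite enormZ yr ger0_norm//; lra.
  have -> : (1 - 5^-1 ^+ 1) * M = (1 - 1 / 5) * M by rewrite expr1 div1r.
  apply: (annulus_decrease Omega v r (nu / 5 * r) M 1 z0) => //.
  - by rewrite mulr_gt0//; lra.
  - by rewrite ltr01 lexx.
  - move=> x' Ox' x'r x'z; rewrite subrr mul0r; apply: vb => //.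
    apply: cap; last by have := xz0 x'; nra.
    apply/eqP; rewrite eq_le x'r/=.
    have := ler_enorm_dist z0 x' 0; rewrite !subr0 enormBC enormZ yr.
    by rewrite ger0_norm; nra.
  - move=> x' Ox' x'r; rewrite leNgt; apply/negP => x'z.
    by apply: (cap x') => //; have := xz0 x'; lra.
  - apply: le_trans (ler_enorm_dist _ p _) _.
    rewrite pz (_ : z1 - z0 = (- (4 * theta + nu / 5)) *: y); last first.
      by rewrite /z1 /z0 -scalerBl; congr (_ *: _); ring.
    rewrite enormZ yr normrN ger0_norm; last by lra.
    by rewrite pz in xp; nra.
(* [p'] divides the segment from [z1] to [p] so that it is j steps from [z1] and one step from [p].
   The inner ball about [p'] is handled by induction, and points within theta r of [p] are within 2
   theta r of [p']. *)
pose l : R := j%:R / j.+1%:R.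
have j1 : 0 < j.+1%:R :> R by rewrite ltr0n.
have l0 : 0 <= l by rewrite divr_ge0.
have l1 : 1 - l = j.+1%:R^-1 by rewrite /l -natr1; field; rewrite natr1 gt_eqF.
have l1' : l <= 1 by rewrite -subr_ge0 l1 invr_ge0.
pose p' := l *: p + (1 - l) *: z1.
have p'r : enorm p' <= (1 - 4 * theta) * r.
  apply: le_trans (ler_enormD _ _) _.
  rewrite (enormZ l) (enormZ (1 - l)) z1r !ger0_norm//; last lra.
  by nra.
have p'z : enorm (p' - z1) <= j%:R * theta * r.
  rewrite (_ : p' - z1 = l *: (p - z1)); last first.
    rewrite /p' scalerBr scalerBl scale1r -addrA; congr (_ + _).
    by rewrite addrC addrA addNr add0r.
  rewrite enormZ ger0_norm//.
  apply: (@le_trans _ _ (l * (j.+1%:R * theta * r))); first by rewrite ler_wpM2l.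
  by rewrite /l -!mulrA mulKf// gt_eqF.
have pp' : enorm (p - p') <= theta * r.
  rewrite (_ : p - p' = (1 - l) *: (p - z1)); last first.
    by rewrite /p' scalerBr (scalerBl _ _ p) scale1r opprD addrA.
  rewrite enormZ l1 ger0_norm ?invr_ge0//.
  by rewrite ler_pdivrMl// mulrA.
have -> : 1 - 5^-1 ^+ j.+2 = 1 - 5^-1 ^+ j.+1 / 5 :> R by rewrite exprSr.
apply: (annulus_decrease Omega v r (theta * r) M _ p') => //.
- by move=> x' Ox' x'r x'p; exact: IH x'p.
- move=> x' _ x'r; have := ler_enorm_dist x' p' 0; rewrite !subr0 x'r; lra.
- by apply: le_trans (ler_enorm_dist _ p _) _; lra.
Qed.

End Decay.

(** * Null sets, and the essential supremum of a continuous function *)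

Section BoxCover.
Context {R : realType}.

(* Induction on the dimension: the slice at height [t] of the last coordinate
   is covered by the slices of the boxes whose last side contains [t], and
   integrating over [t] gives the next dimension.  The predicate [P] selects
   these boxes. *)
Lemma box_cover_volume (n : nat) (a b : nat -> R) (c d : nat -> nat -> R)
    (P : pred nat) :
  (forall i, a i <= b i) -> (forall k i, c k i <= d k i) ->
  (forall x : nat -> R, (forall i, (i < n)%N -> a i <= x i <= b i) ->
     exists2 k, P k & forall i, (i < n)%N -> c k i <= x i <= d k i) ->
  ((\prod_(i < n) (b i - a i))%:E <=
   \sum_(0 <= k <oo) ((P k)%:R * \prod_(i < n) (d k i - c k i))%:E)%E.
Proof.
move=> ab cd.
have vol0 m k : 0 <= \prod_(i < m) (d k i - c k i).
  by apply: prodr_ge0 => i _; rewrite subr_ge0.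
elim: n P => [|n IH] P cover.
  (* In dimension 0 the empty product is 1, and a single selected box already contributes 1. *)
  have [|k Pk _] := cover (fun=> 0); first by [].
  rewrite big_ord0; apply: le_trans (nneseries_lim_ge k.+1 _); last first.
    by move=> j _; rewrite big_ord0 lee_fin mulr1.
  rewrite big_nat_recr//= big_ord0 Pk mulr1 leeDr// sume_ge0// => j _.
  by rewrite big_ord0 lee_fin mulr1.
pose mu := @lebesgue_measure R.
pose D : set R := `[a n, b n]%classic.
pose w k := (P k)%:R * \prod_(i < n) (d k i - c k i).
pose f k (t : R) := ((w k)%:E * (\1_(`[c k n, d k n]%classic) t)%:E)%E.
have w0 k : 0 <= w k by apply: mulr_ge0; [exact: ler0n|exact: vol0].
have mitv (x y : R) : measurable (`[x, y]%classic : set R) by exact: measurable_itv.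
have mD : measurable D := mitv _ _.
have muitv (x y : R) : x <= y -> mu `[x, y]%classic = (y - x)%:E.
  move=> xy; rewrite /mu lebesgue_measure_itv/= lte_fin.
  case: ifPn => [//|]; rewrite -leNgt => yx.
  by rewrite (_ : y = x) ?subrr//; apply: le_anti; rewrite xy yx.
have m1 k : measurable_fun D (EFin \o (\1_(`[c k n, d k n]%classic) : R -> R)).
  by apply/measurable_EFinP; exact: measurable_indic.
have mf k : measurable_fun D (f k).
  exact: (@measurable_funeM _ _ _ D _ (w k)%:E (m1 k)).
have f0 k t : D t -> (0 <= f k t)%E.
  by move=> _; apply: mule_ge0; rewrite lee_fin ?indicE ?ler0n.
have slice t : D t -> ((\prod_(i < n) (b i - a i))%:E <= \sum_(0 <= k <oo) f k t)%E.
  move=> Dt; pose P' k := P k && (t \in `[c k n, d k n]).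
  have := IH P'; rewrite (_ : (\sum_(0 <= k <oo) f k t =
    \sum_(0 <= k <oo) ((P' k)%:R * \prod_(i < n) (d k i - c k i))%:E)%E).
    apply => x xab; pose x' i := if i == n then t else x i.
    have [i|k Pk kx] := cover x'.
      rewrite ltnS leq_eqVlt /x' => /orP[/eqP ->|i_n].
        by rewrite eqxx; move: Dt; rewrite /D/= in_itv.
      by rewrite (ltn_eqF i_n); exact: xab.
    exists k.
      by rewrite /P' Pk in_itv/=; have := kx n (ltnSn n); rewrite /x' eqxx.
    by move=> i i_n; have := kx i (ltnW i_n); rewrite /x' (ltn_eqF i_n).
  apply: eq_eseriesr => k _; rewrite /f /w /P' -EFinM indicE mem_setE.
  by rewrite -mulnb natrM; congr (_%:E); ring.
have V0 : 0 <= \prod_(i < n) (b i - a i).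
  by apply: prodr_ge0 => i _; rewrite subr_ge0.
have : (\int[mu]_(t in D) cst (\prod_(i < n) (b i - a i))%:E t <=
    \int[mu]_(t in D) \sum_(0 <= k <oo) f k t)%E.
  apply: ge0_le_integral => //.
  exact: (@ge0_emeasurable_sum _ (measurableTypeR R) _ _ f xpredT
    (fun k t Dt _ => f0 k t Dt) (fun k _ => mf k)).
rewrite integral_cst//.
rewrite (integral_nneseries mu (mD : measurable (D : set (measurableTypeR R))) mf f0).
rewrite big_ord_recr/= -/mu muitv// -EFinM => /le_trans; apply.
apply: lee_nneseries => [k _ _|k _]; first by apply: integral_ge0 => t; exact: f0.
rewrite ge0_integralZl_EFin//; last exact: m1.
rewrite integral_indic//= big_ord_recr/= mulrA (EFinM (w k)) lee_wpmul2l ?lee_fin//.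
rewrite -muitv//; apply: le_measure; rewrite ?inE//; exact: measurableI.
Qed.

(** An open set around x contains a closed cube of side r, which no family of boxes of total volume
    r^n / 2 can cover. *)
Lemma open_not_lebesgue_null (n : nat) (U : set 'rV[R]_n) (x : 'rV[R]_n) :
  open U -> U x -> ~ lebesgue_null U.
Proof.
move=> oU Ux.
have /nbhs_ballP[r /= r0 xrU] : nbhs x U by exact: (open_nbhs_nbhs (conj oU Ux)).
have e0 : 0 < 2^-1 * \prod_(i < n) r.
  by rewrite mulr_gt0 ?invr_gt0// prodr_gt0.
move=> /(_ _ e0)[c [d [cd Ucd small]]].
(* Rows are extended by 0 to sequences, the format of [box_cover_volume]. *)
pose ext (y : 'rV[R]_n) (i : nat) : R := oapp (y 0) 0 (insub i).
have extE y (i : 'I_n) : ext y i = y 0 i by rewrite /ext valK.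
have ext_cd k i : ext (c k) i <= ext (d k) i.
  by rewrite /ext; case: insubP => //= j _ _; exact: cd.
have ext_x i : ext x i - r / 2 <= ext x i + r / 2 by lra.
have cover (y : nat -> R) :
    (forall i, (i < n)%N -> ext x i - r / 2 <= y i <= ext x i + r / 2) ->
    exists2 k, xpredT k & forall i, (i < n)%N -> ext (c k) i <= y i <= ext (d k) i.
  move=> yx; pose y' : 'rV[R]_n := \row_j y j.
  have [|k _ ky] := Ucd y'.
    apply: xrU; split => // i j; rewrite ord1 /ball/= mxE ltr_norml.
    by have := yx j (ltn_ord j); rewrite extE; lra.
  exists k => // i i_n; have := ky (Ordinal i_n); rewrite mxE.
  by rewrite -!extE.
have := box_cover_volume n _ _ _ _ xpredT ext_x ext_cd cover.
rewrite (eq_bigr (fun=> r)) => [|i _]; last by field.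
rewrite (eq_eseriesr (g := fun k => (\prod_(i < n) (d k 0 i - c k 0 i))%:E)).
  move=> /le_trans/(_ small); rewrite lee_fin.
  have : 0 < \prod_(i < n) r by rewrite prodr_gt0.
  by lra.
by move=> k _; rewrite mul1r; congr EFin; apply: eq_bigr => i _; rewrite !extE.
Qed.

(** If m < |u x|, continuity makes m < |u| on a neighbourhood of x, which is not null; so m is not
    an essential bound. *)
Lemma le_Linfty_norm (n : nat) (U : set 'rV[R]_n) (u : 'rV[R]_n -> R) :
  (0 < n)%N -> open U -> {in U, continuous u} -> [bounded u x | x in U] ->
  forall x, U x -> `|u x| <= Linfty_norm U u.
Proof.
move=> n0 oU cu [M [_ uM]] x Ux; apply: lb_le_inf.
  (* The exceptional set is empty for this bound. Degenerate boxes cover it, with volume 0 since n >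
     0. *)
  exists (Num.max 0 (M + 1)); split; first by rewrite le_max lexx.
  move=> e e0; exists (fun=> 0), (fun=> 0); split => //.
    move=> y [Uy /=]; rewrite gt_max => /andP[_].
    by rewrite ltNge uM// ltrDl.
  rewrite eseries0 ?lee_fin ?ltW// => k _ _; case: (n) n0 => // n' _.
  by rewrite big_ord_recl mxE subrr mul0r.
move=> m [m0 nullm]; rewrite leNgt; apply/negP => mu.
have Ux' : nbhs x U by exact: (open_nbhs_nbhs (conj oU Ux)).
have ux : nbhs x [set y | m < `|u y|].
  apply: (cu x (mem_set Ux) [set t | m < `|t|]).
  apply: open_nbhs_nbhs; split => //=.
  apply: (@open_comp _ _ (fun t : R => `|t|) [set t | m < t]); last exact: open_gt.
  by move=> t _; exact: norm_continuous.
apply: (open_not_lebesgue_null _ _ x (@open_interior _ (U `&` [set y | m < `|u y|]))).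
  exact: filterI Ux' ux.
move=> e /nullm[a [b [ab cov vol]]].
by exists a, b; split => //; exact: subset_trans (@interior_subset _ _) cov.
Qed.
End BoxCover.

(** * Choice of the exponent and iteration over the radii *)

Section HolderBound.
Context {R : realType}.

(** Both logarithms are negative, so beta ln tau >= ln theta as soon as beta <= ln theta / ln
    tau. *)
Lemma exists_small_powR (alpha tau theta : R) :
  0 < alpha -> 0 < tau < 1 -> 0 < theta < 1 ->
  exists2 beta : R, 0 < beta <= alpha & theta <= tau `^ beta.
Proof.
move=> alpha0 /andP[tau0 tau1] theta01; have /andP[theta0 _] := theta01.
have lntau : ln tau < 0 by rewrite ln_lt0// tau0.
have lntheta : ln theta < 0 by rewrite ln_lt0.
exists (Num.min alpha (ln theta / ln tau)).
  by rewrite ge_min lexx lt_min alpha0 nmulr_rgt0// invr_lt0 lntau.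
rewrite /powR gt_eqF// -{1}[theta]lnK ?posrE// ler_expR.
by rewrite -ler_ndivlMr// ge_min lexx orbT.
Qed.

Context {n : nat}.
Implicit Types (x y : 'rV[R]_n) (Omega : set 'rV[R]_n) (v : 'rV[R]_n -> R).

Lemma no_invsq_contactD (c : R) (U : set 'rV[R]_n) v :
  no_invsq_contact U v -> no_invsq_contact U (fun x => v x + c).
Proof.
move=> bv x z d Ux q0 d0 H; apply: (bv x z d Ux q0 d0).
by apply: filterS H => y H /H; lra.
Qed.

Lemma withinD_cst (D : set 'rV[R]_n) v (c : R) :
  {within D, continuous v} -> {within D, continuous (fun x => v x + c)}.
Proof. by move=> cv x; apply: cvgD; [exact: cv|exact: cvg_cst]. Qed.

(** On the ball of radius r_k, k >= 1, v is at most A r_k^beta with A = 4 (M + K), by induction on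
    k. Passing from the radii to |x| costs a factor tau1^(-beta) <= 2, hence the constant 8. *)
Lemma holder_upper_bound (alpha beta tau1 tau2 nu delta : R) Omega
    (r : nat -> R) v (M K : R) :
  0 < beta <= alpha -> 0 < delta <= 1 -> 1 - delta / 2 <= tau1 `^ beta ->
  ball_decay n nu tau2 delta ->
  uniform_condition tau1 tau2 nu r Omega 0 -> r 0%N = 1 ->
  {within closure Omega `&` eball 0 1, continuous v} ->
  no_invsq_contact (Omega `&` eball 0 1) v ->
  0 <= M -> 0 <= K ->
  (forall x, closure Omega x -> enorm x < 1 -> v x <= 2 * M) ->
  (forall x, closure Omega x -> enorm x < 1 -> ~ Omega x ->
     v x <= K * enorm x `^ alpha) ->
  forall x, closure Omega x -> 0 < enorm x < 1 ->
    v x <= 8 * enorm x `^ beta * (M + K).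
Proof.
move=> /andP[beta_gt0 beta_alpha] delta01 tau_beta decay.
move=> [[[_ oO _ _] _] [[t10 t12 t21] _] r_gt0 rr cap] r0 cv bv M0 K0 vM vK.
have /andP[d0 d1] := delta01.
have t1b : 2^-1 <= tau1 `^ beta by lra.
have rtau1 k : tau1 * r k <= r k.+1 by have /andP[] := rr k.
have rtau2 k : r k.+1 <= tau2 * r k by have /andP[] := rr k.
have r1 k : r k.+1 < 1.
  elim: k => [|k IH]; apply: le_lt_trans (rtau2 _) _; first by rewrite r0 mulr1.
  by have := r_gt0 k.+1; nra.
have powle (a b : R) : 0 <= a -> a <= b -> a `^ beta <= b `^ beta.
  by move=> a0 ab; apply: ge0_ler_powR; rewrite ?nnegrE ?(le_trans a0 ab) ?(ltW beta_gt0).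
have powr k : tau1 `^ beta * r k `^ beta <= r k.+1 `^ beta.
  rewrite -(powRM _ (ltW t10) (ltW (r_gt0 k))); apply: powle.
    by rewrite mulr_ge0// ltW.
  exact: rtau1.
pose A := 4 * (M + K).
have A0 : 0 <= A by rewrite /A; lra.
(* The induction starts at [r 1] because [ball_decay] needs a radius below 1. There r_1^beta >= 1/2
   gives A r_1^beta >= 2 M. *)
have levels k : forall x, closure Omega x -> enorm x <= r k.+1 ->
    v x <= A * r k.+1 `^ beta.
  elim: k => [|k IH] x Ox xr.
    apply: le_trans (vM x Ox (le_lt_trans xr (r1 0%N))) _.
    have := powr 0%N; rewrite r0 powR1 mulr1 => h.
    have : 2^-1 <= r 1%N `^ beta by exact: le_trans h.
    by rewrite /A; nra.
  set rho := r k.+1 in IH *.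
  have rho0 : 0 < rho := r_gt0 _.
  have rho1 : rho < 1 := r1 k.
  have rab : rho `^ alpha <= rho `^ beta.
    by apply: ger_powR => //; rewrite rho0 ltW.
  have rb0 : 0 <= rho `^ beta := powR_ge0 _ _.
  have ra0 : 0 <= rho `^ alpha := powR_ge0 _ _.
  pose G := K * rho `^ alpha; pose S := A * rho `^ beta.
  have G0 : 0 <= G by rewrite mulr_ge0.
  (* This makes S - G nonnegative, and it also gives (1 - delta) S + delta G <= (1 - delta / 2) S,
     which the choice of beta absorbs. *)
  have GS : 4 * G <= S by rewrite /G /S /A; nra.
  have [y yb ycap] := cap k.+1; rewrite boundary_eball// in yb ycap.
  (* Subtracting [G], the largest boundary value allowed on this ball, makes the function
     nonpositive off [Omega]. *)
  have : v x + - G <= (1 - delta) * (S - G).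
    apply: (decay Omega (fun x => v x + - G) rho (S - G) y) => //.
    - by rewrite rho0.
    - by lra.
    - exact: withinD_cst.
    - exact: no_invsq_contactD.
    - by move=> x' Ox' x'r; rewrite lerD2r; exact: IH.
    - move=> x' Ox' x'r nO; have := vK x' Ox' (le_lt_trans x'r rho1) nO.
      suff : K * enorm x' `^ alpha <= G by lra.
      rewrite ler_wpM2l//; apply: ge0_ler_powR; rewrite ?nnegrE ?enorm_ge0//.
        exact: ltW (lt_le_trans beta_gt0 beta_alpha).
      exact: ltW.
    - by move=> x' x'r x'y; apply: (ycap x').
    - exact: le_trans xr (rtau2 _).
  have := powr k.+1; rewrite -/rho => h.
  have : A * (tau1 `^ beta * rho `^ beta) <= A * r k.+2 `^ beta by rewrite ler_wpM2l.
  have : (1 - delta / 2) * S <= A * (tau1 `^ beta * rho `^ beta).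
    by rewrite (mulrCA A) -/S ler_wpM2r// mulr_ge0.
  by nra.
move=> x Ox /andP[x0 x1].
have ex : exists k, r k < enorm x.
  have rk k : r k <= tau2 ^+ k.
    elim: k => [|k IH]; first by rewrite r0 expr0.
    apply: le_trans (rtau2 k) _.
    by rewrite exprS ler_wpM2l// ltW// (lt_trans t10).
  have t2n : `|tau2| < 1 by rewrite gtr0_norm//; lra.
  have /cvgrPdist_lt/(_ _ x0)[k _ /(_ k (leqnn k))] := cvg_expr t2n.
  rewrite /= sub0r normrN => h; exists k; apply: le_lt_trans (rk k) _.
  exact: le_lt_trans (ler_norm _) h.
(* The first radius below |x| cannot be r_0 = 1. If it is r_1, then |x|^beta >= 1/2 and the bound 2
   M suffices; otherwise r_(k+2) < |x| <= r_(k+1). *)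
have [[|[|k]] rx minx] := ex_minnP ex.
- by rewrite r0 in rx; lra.
- have := powr 0%N; rewrite r0 powR1 mulr1 => h.
  have : 2^-1 <= enorm x `^ beta.
    apply: le_trans (le_trans t1b h) _.
    exact: powle _ _ (ltW (r_gt0 1%N)) (ltW rx).
  by have := vM x Ox x1; nra.
have xr : enorm x <= r k.+1.
  by rewrite leNgt; apply/negP => /minx; rewrite ltnn.
have : r k.+1 `^ beta <= 2 * enorm x `^ beta.
  have := powr k.+1; have := powle _ _ (ltW (r_gt0 k.+2)) (ltW rx).
  have : 0 <= r k.+1 `^ beta := powR_ge0 _ _.
  by nra.
have := levels k x Ox xr; rewrite /A.
have : 0 <= M + K by lra.
by nra.
Qed.

End HolderBound.

(** * Boundary values, the seminorm, and the conclusion *)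

(** If M < |u x| at a closure point x, this persists by continuity at nearby points of Omega. *)
Lemma closure_normr_bound (R : realType) (n : nat) (Omega : set 'rV[R]_n)
    (u : 'rV[R]_n -> R) (M : R) :
  {within closure Omega `&` eball 0 1, continuous u} ->
  (forall x, (Omega `&` eball 0 1) x -> `|u x| <= M) ->
  forall x, (closure Omega `&` eball 0 1) x -> `|u x| <= M.
Proof.
move=> /subspace_continuousP cu uM x Dx; rewrite leNgt; apply/negP => Mu.
have : within (closure Omega `&` eball 0 1) (nbhs x) [set y | M < `|u y|].
  apply: (cu x Dx [set t | M < `|t|]); apply: open_nbhs_nbhs; split => //=.
  apply: (@open_comp _ _ (fun t : R => `|t|) [set t | M < t]); last exact: open_gt.
  by move=> t _; exact: norm_continuous.
rewrite /within/= => nu; case: Dx => Ox Bx.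
have nB : nbhs x (eball 0 1 : set 'rV[R]_n).
  exact: (open_nbhs_nbhs (conj (open_eball 0 1) Bx)).
have [y [Oy [/= My By]]] := Ox _ (filterI nu nB).
have := uM y (conj Oy By); rewrite leNgt => /negP; apply; apply: My.
by split => //; exact: subset_closure.
Qed.

Lemma holder_seminorm_ge0 (R : realType) (n : nat) (gamma : R)
    (D : set 'rV[R]_n) (f : 'rV[R]_n -> R) (x0 : 'rV[R]_n) :
  holder_at gamma D f x0 -> 0 <= holder_seminorm gamma D f x0.
Proof. by move=> h; apply: lb_le_inf => // K []. Qed.

(** The infimum is itself an admissible constant: for x != x0, divide by |x - x0|^gamma; at x0 both
    sides are handled directly. *)
Lemma holder_seminormP (R : realType) (n : nat) (gamma : R)
    (D : set 'rV[R]_n) (f : 'rV[R]_n -> R) (x0 : 'rV[R]_n) :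
  holder_at gamma D f x0 -> forall x, D x ->
  `|f x - f x0| <= holder_seminorm gamma D f x0 * enorm (x - x0) `^ gamma.
Proof.
move=> h x Dx; have [xx0|xx0] := eqVneq (enorm (x - x0)) 0.
  have /subr0_eq -> := enorm_eq0 _ xx0; rewrite subrr normr0.
  by rewrite mulr_ge0 ?powR_ge0 ?holder_seminorm_ge0.
have p0 : 0 < enorm (x - x0) `^ gamma.
  by rewrite powR_gt0// lt_neqAle eq_sym xx0 enorm_ge0.
rewrite -ler_pdivrMr//; apply: lb_le_inf => // K [_ /(_ x Dx)].
by rewrite ler_pdivrMr.
Qed.

Theorem theorem0p2 (R : realType) (n : nat) (alpha tau1 tau2 nu : R)
    (hn : (1 <= n)%N) (halpha : 0 < alpha)
    (htau1 : 0 < tau1) (htau12 : tau1 < tau2) (htau2 : tau2 < 1)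
    (hnu0 : 0 < nu) (hnu1 : nu < 1) :
  exists beta : R, 0 < beta /\ beta <= alpha /\
    forall (Omega : set 'rV[R]_n) (r : nat -> R) (g u : 'rV[R]_n -> R),
      bounded_domain Omega ->
      boundary Omega 0 ->
      uniform_condition tau1 tau2 nu r Omega 0 ->
      r 0%N = 1 ->
      holder_at alpha (boundary Omega `&` eball 0 1) g 0 ->
      [bounded u x | x in closure Omega `&` eball 0 1] ->
      viscosity_solution Omega g u ->
      holder_at beta (closure Omega `&` eball 0 1) u 0 /\
      forall x : 'rV[R]_n, (Omega `&` eball 0 1) x ->
        `|u x - u 0| <= 8 * enorm x `^ beta *
          (Linfty_norm (Omega `&` eball 0 1) u
           + holder_seminorm alpha (boundary Omega `&` eball 0 1) g 0).
Proof.
have [delta delta01 decay] : exists2 delta : R, 0 < delta <= 1 &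
    forall n, ball_decay n nu tau2 delta.
  by apply: ball_decay_exists => //; rewrite hnu0.
have /andP[d0 d1] := delta01.
have [beta beta_alpha tau_beta] : exists2 beta : R, 0 < beta <= alpha &
    1 - delta / 2 <= tau1 `^ beta.
  apply: exists_small_powR => //; first by rewrite htau1 (lt_trans htau12).
  by apply/andP; split; lra.
have /andP[beta0 beta_le] := beta_alpha.
exists beta; split => //; split => //.
move=> Omega r g u [_ oO _ _] b0 unif r0 hg ub [cu usub usup ug].
pose D : set 'rV[R]_n := closure Omega `&` eball 0 1.
pose U : set 'rV[R]_n := Omega `&` eball 0 1.
have oU : open U by apply: openI => //; exact: open_eball.
have UD : U `<=` D by move=> x [Ox Bx]; split => //; exact: subset_closure.
have eballE (x : 'rV[R]_n) : eball 0 1 x = (enorm x < 1) :> Prop.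
  by rewrite /eball/= subr0.
have B0 : eball 0 1 (0 : 'rV[R]_n) by rewrite eballE enorm0 ltr01.
set M := Linfty_norm _ _; set K := holder_seminorm _ _ _ _.
have uM : forall x, D x -> `|u x| <= M.
  apply: closure_normr_bound => //; apply: le_Linfty_norm => //.
    by rewrite -continuous_open_subspace//; exact: continuous_subspaceW cu.
  by case: ub => m [mr bm]; exists m; split => // k /bm ubk x Ux; exact: ubk (UD x Ux).
have D0 : D 0 by split => //; case: b0.
have M0 : 0 <= M := le_trans (normr_ge0 _) (uM 0 D0).
have K0 : 0 <= K by exact: holder_seminorm_ge0 hg.
(* Since [Omega] is open, a closure point outside it is a boundary point, where u = g; the same
   holds at 0. *)
have uK x : D x -> ~ Omega x -> `|u x - u 0| <= K * enorm x `^ alpha.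
  move=> [Ox Bx] nO.
  have bx : (boundary Omega `&` eball 0 1) x.
    by split => //; split => //; rewrite (interior_id _).1.
  rewrite (ug x bx) (ug 0 (conj b0 B0)).
  by have := holder_seminormP _ _ _ _ _ _ hg x bx; rewrite subr0.
have bound x : D x -> 0 < enorm x -> `|u x - u 0| <= 8 * enorm x `^ beta * (M + K).
  move=> Dx x0; have [Ox Bx] := Dx; rewrite eballE in Bx.
  have x01 : 0 < enorm x < 1 by rewrite x0.
  have := uM 0 D0; rewrite ler_norml => /andP[u01 u02].
  have inD y : closure Omega y -> enorm y < 1 -> D y.
    by move=> Oy y1; split => //; rewrite eballE.
  (* The lower bound is the upper bound for u(0) - u. In both cases |u| <= M gives the bound 2 M on
     the difference. *)
  rewrite ler_norml; apply/andP; split.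
    rewrite lerNl opprB addrC.
    apply: (@holder_upper_bound R n alpha beta tau1 tau2 nu delta
      Omega r (fun y => - u y + u 0) M K beta_alpha delta01 tau_beta (decay n)
      unif r0) => //.
    - apply: withinD_cst => y; apply: cvgN; exact: cu.
    - exact/no_invsq_contactD/supersolution_no_invsq_contact.
    - by move=> y Oy y1; have := uM y (inD y Oy y1); rewrite ler_norml => /andP[]; lra.
    - move=> y Oy y1 nO; have := uK y (inD y Oy y1) nO.
      by rewrite ler_norml => /andP[]; lra.
  apply: (@holder_upper_bound R n alpha beta tau1 tau2 nu delta
      Omega r (fun y => u y - u 0) M K beta_alpha delta01 tau_beta (decay n)
      unif r0) => //.
  - exact: withinD_cst.
  - exact/no_invsq_contactD/subsolution_no_invsq_contact.
  - by move=> y Oy y1; have := uM y (inD y Oy y1); rewrite ler_norml => /andP[]; lra.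
  - move=> y Oy y1 nO; have := uK y (inD y Oy y1) nO.
    by rewrite ler_norml => /andP[]; lra.
have uzero (x : 'rV[R]_n) : ~ (0 < enorm x) -> x = 0.
  move=> /negP; rewrite -leNgt => x0; apply: enorm_eq0; apply: le_anti.
  by rewrite x0 enorm_ge0.
split.
  (* The estimate was proved for x != 0; at x = 0 the left side vanishes. *)
  exists (8 * (M + K)); split; first by rewrite mulr_ge0// addr_ge0.
  move=> x Dx; rewrite subr0 mulrAC.
  have [x0|/uzero ->] := pselect (0 < enorm x); first exact: bound.
  by rewrite subrr normr0 !mulr_ge0// ?addr_ge0// powR_ge0.
move=> x Ux.
have [x0|/uzero ->] := pselect (0 < enorm x); first exact: bound (UD x Ux) x0.
by rewrite subrr normr0 !mulr_ge0// ?addr_ge0// powR_ge0.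
Qed.
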